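(* For every integer $n\ge 1$, with $q=\lfloor (n-1)/2\rfloor$, there is exactly one shell traversal $(r_0,r_1,\ldots,r_q)$ satisfying the maximal-radial-contrast rule. It is $$0,\ q,\ 1,\ q-1,\ 2,\ q-2,\ldots;$$ more explicitly, $r_0=0$ and, for $1\le k\le q$, $$r_k=\begin{cases} q-\dfrac{k-1}{2}, & k \text{ odd},\\[6pt] \dfrac{k}{2}, & k\text{ even}.\end{cases}$$ Moreover, at every nonterminal step the maximizing shell is unique: for each $1\le k\le q$, the set $\operatorname{arg\,max}_{r\in\{0,\ldots,q\}\setminus\{r_0,\ldots,r_{k-1}\}}|r-r_{k-1}|$ has exactly one element.
   Context: Fix $n\ge 1$, let $[n]=\{1,\ldots,n\}$ with its usual order, and put $a=\lfloor (n+1)/2\rfloor$, $b=\lceil (n+1)/2\rceil$, $q=\lfloor (n-1)/2\rfloor$. For $r\in\{0,1,\ldots,q\}$ the bilateral shell of normalized radius $r$ is $B_r=\{a-r,\,b+r\}$ (a singleton exactly when $n$ is odd and $r=0$); the shells partition $[n]$. A shell traversal is a permutation $(r_0,r_1,\ldots,r_q)$ of $\{0,1,\ldots,q\}$; it represents the block sequence $(B_{r_0},\ldots,B_{r_q})$. A shell traversal satisfies the maximal-radial-contrast rule when (i) $r_0=0$, and (ii) for each $1\le k\le q$, $r_k\in\operatorname{arg\,max}_{r\in\{0,\ldots,q\}\setminus\{r_0,\ldots,r_{k-1}\}}|r-r_{k-1}|$. A nonterminal step is one at which at least one shell is still unvisited. *)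

(* Defs.v *)
From mathcomp Require Import all_boot all_order all_fingroup all_algebra.
Set Implicit Arguments.
Unset Strict Implicit.
Unset Printing Implicit Defensive.

Definition max_radius (n : nat) : nat := (n - 1)./2.

Definition argmax (T : finType) (A : {set T}) (f : T -> nat) : {set T} :=
  [set x in A | [forall y in A, f y <= f x]].

Notation shell_traversal q := {perm 'I_q.+1} (only parsing).

(* Steps are natural numbers, so that k-1 needs no ordinal arithmetic; [inord]
   makes this total, and only steps k <= q are ever meaningful. *)
Definition radius_at (q : nat) (r : shell_traversal q) (k : nat) : 'I_q.+1 :=
  r (inord k).

Definition unvisited (q : nat) (r : shell_traversal q) (k : nat) :
    {set 'I_q.+1} :=
  ~: [set radius_at r j | j : 'I_k].

(* `|x - y|%N is the distance |x - y| in nat: the subtraction is in int. *)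
Definition contrast_maximizers (q : nat) (r : shell_traversal q) (k : nat) :
    {set 'I_q.+1} :=
  argmax (unvisited r k) (fun x => `|x - radius_at r k.-1|%N).

Definition max_radial_contrast (q : nat) (r : shell_traversal q) : Prop :=
  radius_at r 0 = ord0 /\
  forall k : nat, 1 <= k <= q -> radius_at r k \in contrast_maximizers r k.

(* Main.v *)
Require Import Defs.
From mathcomp Require Import all_boot all_order all_fingroup all_algebra.
From mathcomp Require Import zify.

Set Implicit Arguments.
Unset Strict Implicit.
Unset Printing Implicit Defensive.

(** The rule leaves no freedom because, as long as it is followed, the unvisited
    radii form an interval and the current radius lies just outside of it.  The
    visited radii are a bottom segment of [0, q], taken at the even steps, and a
    top segment, taken at the odd steps, so before step [k] the unvisited radii
    are those in [uphalf k, q - k./2] ([mem_unvisited]).  The radius visited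
    last is the neighbour of one end of this interval, so the distance to it is
    strictly monotone on the interval, and its maximum is attained at the
    opposite end only, which is the next zigzag value
    ([contrast_maximizers_zigzag]).

    By strong induction on the step, every traversal obeying the rule is
    therefore the zigzag ([max_radial_contrast_zigzag]), which gives the
    explicit formula, the single maximizer at each step and uniqueness.  For
    existence, the zigzag is injective on [0, q], hence a permutation, and the
    same computation of the maximizers shows that this permutation obeys the
    rule. *)

Definition zigzag (q k : nat) : nat := if odd k then q - k./2 else k./2.

Lemma zigzag_le q k : k <= q -> zigzag q k <= q.
Proof. by rewrite /zigzag; case: ifP; lia. Qed.

Lemma zigzag_inj q i j : i <= q -> j <= q -> zigzag q i = zigzag q j -> i = j.
Proof. by rewrite /zigzag; case: ifP; case: ifP; lia. Qed.

(** Even steps fill [0, q] from the bottom and odd steps from the top, at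
    the same pace. *)
Lemma zigzag_visited q k x : k <= q -> x <= q ->
  (exists2 j, j < k & zigzag q j = x) <-> ~~ (uphalf k <= x <= q - k./2).
Proof.
move=> kq xq; split=> [[j jk <-]|out].
  by rewrite /zigzag; case: ifP; lia.
have [lo|hi] := ltnP x (uphalf k).
  by exists x.*2; rewrite /zigzag ?odd_double ?doubleK //; lia.
by exists (q - x).*2.+1; rewrite /zigzag /= ?odd_double /= ?uphalf_double; lia.
Qed.

(** Shell traversals are compared with the zigzag on an initial segment only:
    the induction that identifies the two knows nothing about later steps. *)
Definition follows_zigzag q (r : {perm 'I_q.+1}) (k : nat) : Prop :=
  forall j, j < k -> radius_at r j = zigzag q j :> nat.

Lemma mem_unvisited q (r : {perm 'I_q.+1}) k x :
    k <= q -> follows_zigzag r k ->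
  (x \in unvisited r k) = (uphalf k <= x <= q - k./2).
Proof.
move=> kq rz; have xq : x <= q by rewrite -ltnS ltn_ord.
rewrite inE -[RHS]negbK; congr (~~ _).
apply/imsetP/idP=> [[j _ ->]|/(zigzag_visited kq xq)[j jk jx]].
  apply/(zigzag_visited kq); first by rewrite -ltnS ltn_ord.
  by exists j; rewrite ?rz.
by exists (Ordinal jk) => //; apply: val_inj; rewrite /= rz.
Qed.

(** At an odd step the last radius is just below the unvisited interval, so the
    farthest point is the upper end; at an even step it is just above, and the
    farthest point is the lower end. *)
Lemma contrast_maximizers_zigzag q (r : {perm 'I_q.+1}) k :
    1 <= k <= q -> follows_zigzag r k ->
  contrast_maximizers r k = [set inord (zigzag q k)].
Proof.
move=> /andP[k0 kq] rz.
have zE : (inord (zigzag q k) : 'I_q.+1) = zigzag q k :> nat.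
  by rewrite inordK // ltnS zigzag_le.
have pE : radius_at r k.-1 = zigzag q k.-1 :> nat by apply: rz; lia.
have zU : inord (zigzag q k) \in unvisited r k.
  by rewrite mem_unvisited // zE /zigzag; case: ifP; lia.
apply/setP=> x; rewrite in_set1 inE.
apply/andP/eqP=> [[xU /forall_inP/(_ _ zU)]|->].
  move: xU; rewrite mem_unvisited // zE pE => xU far.
  apply: val_inj; rewrite /= zE; move: xU far.
  by rewrite /zigzag; case: ifP; case: ifP; lia.
split=> //; apply/forall_inP=> y; rewrite mem_unvisited // zE pE.
by rewrite /zigzag; case: ifP; case: ifP; lia.
Qed.

Lemma max_radial_contrast_zigzag q (r : {perm 'I_q.+1}) :
  max_radial_contrast r <-> follows_zigzag r q.+1.
Proof.
split=> [[r0 rmax] j|rz].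
  elim/ltn_ind: j => -[|k] IH kq; first by rewrite r0.
  have := rmax k.+1 kq; rewrite contrast_maximizers_zigzag //.
    by rewrite in_set1 => /eqP ->; rewrite inordK // ltnS zigzag_le.
  by move=> j jk; apply: IH => //; lia.
split=> [|k kq]; first by apply: val_inj; rewrite /= rz.
rewrite contrast_maximizers_zigzag //; last by move=> j jk; apply: rz; lia.
rewrite in_set1; apply/eqP/val_inj.
by rewrite /= inordK ?rz ?ltnS ?zigzag_le; lia.
Qed.

Lemma zigzag_ord_inj q :
  injective (fun i : 'I_q.+1 => inord (zigzag q i) : 'I_q.+1).
Proof.
move=> i j /(congr1 val) /=.
have le_q (l : 'I_q.+1) : l <= q by rewrite -ltnS ltn_ord.
rewrite !inordK ?ltnS ?zigzag_le // => ij.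
by apply: val_inj; apply: zigzag_inj ij.
Qed.

Lemma follows_zigzag_unique q (r s : {perm 'I_q.+1}) :
  follows_zigzag r q.+1 -> follows_zigzag s q.+1 -> r = s.
Proof.
move=> rz sz; apply/permP=> i; apply: val_inj.
by have := rz i (ltn_ord i); rewrite -sz // /radius_at inord_val.
Qed.

Theorem theorem3p2 (n : nat) (hn : 1 <= n) :
  let q := max_radius n in
  (exists! r : shell_traversal q, max_radial_contrast r) /\
  (forall r : shell_traversal q, max_radial_contrast r ->
     [/\ radius_at r 0 = 0 :> nat,
         (forall k : nat, 1 <= k <= q ->
            radius_at r k = (if odd k then q - (k - 1)./2 else k./2) :> nat)
       & (forall k : nat, 1 <= k <= q -> #|contrast_maximizers r k| = 1)]).
Proof.
move=> q; split.
  exists (perm (@zigzag_ord_inj q)); split=> [|s].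
    apply/max_radial_contrast_zigzag=> j jq.
    by rewrite /radius_at permE !inordK // ltnS zigzag_le.
  move=> /max_radial_contrast_zigzag sz.
  apply: follows_zigzag_unique sz => j jq.
  by rewrite /radius_at permE !inordK // ltnS zigzag_le.
move=> r /max_radial_contrast_zigzag rz; split=> [|k kq|k kq].
- by rewrite rz.
- by rewrite rz /zigzag; [case: ifP|]; lia.
rewrite contrast_maximizers_zigzag ?cards1 // => j jk.
by apply: rz; lia.
Qed.
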